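(* Let $l\ge17$ be a prime and $m=4-3l^2$. Let $\omega_1,\omega_2,\omega_3\in\mathbb{Z}_{\ge2}\cup\{\infty\}$ with (at least) one $\omega_i$ finite. If $-3$ is a square modulo $84+l^2$, then $(\mathcal{X}_m,\mathcal{D}_{\underline\omega})^*_{\mathrm{str}}(\mathbb{Z})\ne\emptyset$ (for both Campana and Darmon points).
   Context: $U_m\subset\mathbb{A}^3_{\mathbb{Q}}$ is $u_1^2+u_2^2+u_3^2-u_1u_2u_3=m$; $\mathcal{X}_m\subset\mathbb{P}^3_{\mathbb{Z}}$ is $x_0(x_1^2+x_2^2+x_3^2)-x_1x_2x_3=mx_0^3$ with generic fibre $X_m$, $U_m=X_m\cap\{x_0\ne0\}$ via $u_j=x_j/x_0$. $D_j=\{x_0=x_j=0\}$, $\mathcal{D}_j$ its closure in $\mathcal{X}_m$, $\mathcal{D}_{\underline\omega}=\sum(1-1/\omega_j)\mathcal{D}_j$, $\mathcal{D}_{\inf}=\bigcup_{\omega_j=\infty}\mathcal{D}_j$. For a prime $p$ and $M_p\in\mathcal{X}_m(\mathbb{Z}_p)$, write $\mathrm{Spec}\,\mathbb{Z}_p\times_{\mathcal{X}_m}\mathcal{D}_j=\mathrm{Spec}(\mathbb{Z}_p/I)$, $n_p(\mathcal{D}_j,M_p)=\infty$ if $I=0$, $=n$ if $I=(p^n)$. $(\mathcal{X}_m,\mathcal{D}_{\underline\omega})^*_{\mathrm{str}}(\mathbb{Z})$ is the set of $M\in U_m(\mathbb{Q})$ such that for every prime $p$, $M\in(\mathcal{X}_m\setminus\mathcal{D}_{\inf})(\mathbb{Z}_p)$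 and for every $j$ with $\omega_j<\infty$, $n_p(\mathcal{D}_j,M)\in\mathbb{Z}_{\ge\omega_j}\cup\{0,\infty\}$ (Campana) resp. $\in\omega_j\mathbb{Z}_{\ge0}\cup\{\infty\}$ (Darmon). *)

(* Defs.v *)
From HB Require Import structures.
From mathcomp Require Import all_boot all_order all_algebra.
From mathcomp Require Import boolp.
From mathcomp Require Import mpoly.

Set Implicit Arguments.
Unset Strict Implicit.
Unset Printing Implicit Defensive.

Import Order.TTheory GRing.Theory Num.Theory.
Local Open Scope ring_scope.

Record prime_nat := PrimeNat { prime_val :> nat; primeP_nat : prime prime_val }.

(* The ring of p-adic integers as the inverse limit of the rings Z/p^n; the   *)
(* component in Z/p^n is stored as its representative in [0, p^n).            *)
Record padic_int (p : prime_nat) := MkPadicInt {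
  zres :> nat -> int;
  zresP : forall n, zres n = (zres n.+1 %% (p%:Z ^+ n))%Z
}.

Lemma padic_ext (p : prime_nat) (a b : padic_int p) :
  (forall n, a n = b n) -> a = b.
Proof.
case: a b => [a aP] [b bP] /= eab.
have {}eab : a = b by apply/funext.
by subst b; congr MkPadicInt; apply: Prop_irrelevance.
Qed.

Lemma modz_pX (p : prime_nat) (n k : nat) (x : int) : (n <= k)%N ->
  ((x %% (p%:Z ^+ k))%Z %% (p%:Z ^+ n))%Z = (x %% (p%:Z ^+ n))%Z.
Proof.
move=> le_nk; rewrite [in RHS](divz_eq x (p%:Z ^+ k)).
by rewrite -(subnK le_nk) exprD mulrA modzMDl.
Qed.

Definition coherent (p : prime_nat) (f : nat -> int) :=
  forall n, (f n.+1 = f n %[mod p%:Z ^+ n])%Z.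

Lemma padic_of_proof (p : prime_nat) (f : nat -> int) : coherent p f ->
  forall n, (f n %% (p%:Z ^+ n))%Z
            = ((f n.+1 %% (p%:Z ^+ n.+1))%Z %% (p%:Z ^+ n))%Z.
Proof. by move=> fP n; rewrite modz_pX // fP. Qed.

Definition padic_of (p : prime_nat) (f : nat -> int) (fP : coherent p f) :
    padic_int p :=
  MkPadicInt (padic_of_proof fP).

Lemma zres_mod (p : prime_nat) (a : padic_int p) n :
  (a n %% (p%:Z ^+ n))%Z = a n.
Proof. by rewrite [in LHS]zresP modz_mod -zresP. Qed.

Lemma zres_coherent (p : prime_nat) (a : padic_int p) : coherent p a.
Proof. by move=> n; rewrite -zresP zres_mod. Qed.

Lemma coherent_cst (p : prime_nat) (z : int) : coherent p (fun=> z).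
Proof. by []. Qed.

Lemma coherent_opp (p : prime_nat) (a : padic_int p) :
  coherent p (fun n => - a n).
Proof. by move=> n; rewrite -modzNm zres_coherent modzNm. Qed.

Lemma coherent_add (p : prime_nat) (a b : padic_int p) :
  coherent p (fun n => a n + b n).
Proof. by move=> n; rewrite -modzDm !zres_coherent modzDm. Qed.

Lemma coherent_mul (p : prime_nat) (a b : padic_int p) :
  coherent p (fun n => a n * b n).
Proof. by move=> n; rewrite -modzMm !zres_coherent modzMm. Qed.

Definition padic_cst (p : prime_nat) (z : int) := padic_of (coherent_cst p z).
Definition padic_opp (p : prime_nat) (a : padic_int p) :=
  padic_of (coherent_opp a).
Definition padic_add (p : prime_nat) (a b : padic_int p) :=
  padic_of (coherent_add a b).
Definition padic_mul (p : prime_nat) (a b : padic_int p) :=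
  padic_of (coherent_mul a b).

Lemma padic_addA (p : prime_nat) : associative (@padic_add p).
Proof.
by move=> a b c; apply: padic_ext => n /=;
rewrite modzDmr modzDml addrA.
Qed.

Lemma padic_addC (p : prime_nat) : commutative (@padic_add p).
Proof.
by move=> a b; apply: padic_ext => n /=;
rewrite addrC.
Qed.

Lemma padic_add0 (p : prime_nat) : left_id (padic_cst p 0) (@padic_add p).
Proof.
by move=> a; apply: padic_ext => n /=;
rewrite modzDml add0r zres_mod.
Qed.

Lemma padic_addN (p : prime_nat) :
  left_inverse (padic_cst p 0) (@padic_opp p) (@padic_add p).
Proof.
by move=> a; apply: padic_ext => n /=;
rewrite modzDml addNr.
Qed.

Lemma padic_mulA (p : prime_nat) : associative (@padic_mul p).
Proof.
by move=> a b c; apply: padic_ext => n /=;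
rewrite modzMmr modzMml mulrA.
Qed.

Lemma padic_mulC (p : prime_nat) : commutative (@padic_mul p).
Proof.
by move=> a b; apply: padic_ext => n /=;
rewrite mulrC.
Qed.

Lemma padic_mul1 (p : prime_nat) : left_id (padic_cst p 1) (@padic_mul p).
Proof.
by move=> a; apply: padic_ext => n /=;
rewrite modzMml mul1r zres_mod.
Qed.

Lemma padic_mulDl (p : prime_nat) :
  left_distributive (@padic_mul p) (@padic_add p).
Proof.
by move=> a b c; apply: padic_ext => n /=; rewrite modzMml modzDm mulrDl.
Qed.

HB.instance Definition _ (p : prime_nat) := gen_eqMixin (padic_int p).
HB.instance Definition _ (p : prime_nat) := gen_choiceMixin (padic_int p).
HB.instance Definition _ (p : prime_nat) := GRing.isZmodule.Build (padic_int p)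
  (@padic_addA p) (@padic_addC p) (@padic_add0 p) (@padic_addN p).

Lemma padic_1neq0 (p : prime_nat) : padic_cst p 1 != 0.
Proof.
apply/eqP => /(congr1 (fun a : padic_int p => a 1%N)) /=.
have p1 := prime_gt1 (primeP_nat p).
by rewrite mod0z expr1 modz_small //= ltz_nat p1.
Qed.

HB.instance Definition _ (p : prime_nat) :=
  GRing.Zmodule_isComNzRing.Build (padic_int p)
    (@padic_mulA p) (@padic_mulC p) (@padic_mul1 p) (@padic_mulDl p)
    (padic_1neq0 p).

Definition padic_unit (p : prime_nat) : {pred padic_int p} :=
  fun a => `[< exists b : padic_int p, b * a = 1 >].

Definition padic_inv (p : prime_nat) (a : padic_int p) : padic_int p :=
  if pselect (exists b : padic_int p, b * a = 1) is left h
  then projT1 (cid h) else a.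

Lemma padic_mulV (p : prime_nat) :
  {in @padic_unit p, left_inverse (1 : padic_int p) (@padic_inv p) *%R}.
Proof.
move=> a /asboolP ha; rewrite /padic_inv; case: pselect => // h.
exact: (projT2 (cid h)).
Qed.

Lemma padic_unitP (p : prime_nat) (a b : padic_int p) :
  b * a = 1 -> padic_unit a.
Proof. by move=> ba; apply/asboolP; exists b. Qed.

Lemma padic_inv_out (p : prime_nat) :
  {in [predC @padic_unit p], @padic_inv p =1 id}.
Proof. by move=> a /asboolP ha; rewrite /padic_inv; case: pselect. Qed.

HB.instance Definition _ (p : prime_nat) :=
  GRing.ComNzRing_hasMulInverse.Build (padic_int p)
    (@padic_mulV p) (@padic_unitP p) (@padic_inv_out p).

Lemma zres_add (p : prime_nat) (a : padic_int p) n k :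
  (a (n + k)%N %% (p%:Z ^+ n))%Z = a n.
Proof.
elim: k => [|k IHk]; first by rewrite addn0 zres_mod.
rewrite addnS -(modz_pX _ _ (leq_addr k n)).
by rewrite -zresP IHk.
Qed.

Lemma padic_neq0 (p : prime_nat) (a : padic_int p) :
  a != 0 -> exists n, a n != 0.
Proof.
move=> a0; apply: contrapT => /forallNP h; case/eqP: a0; apply: padic_ext => n.
by move/negP: (h n); rewrite negbK => /eqP -> /=; rewrite mod0z.
Qed.

Lemma padic_integral (p : prime_nat) :
  GRing.integral_domain_axiom (padic_int p).
Proof.
move=> a b ab0; apply/norP => -[/padic_neq0 [n an] /padic_neq0 [k bk]].
have /(congr1 (fun c : padic_int p => c (n + k)%N)) /= := ab0.
rewrite mod0z => /dvdz_mod0P.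
have {an} : ~~ (p%:Z ^+ n %| a (n + k)%N)%Z.
  by apply: contra an => /dvdz_mod0P; rewrite zres_add => ->.
have {bk} : ~~ (p%:Z ^+ k %| b (n + k)%N)%Z.
  by apply: contra bk => /dvdz_mod0P; rewrite addnC zres_add => ->.
rewrite !dvdzE !abszX abszM /=.
have [->|b0] := posnP `|b (n + k)%N|; first by rewrite dvdn0.
have [->|a0] := posnP `|a (n + k)%N|; first by rewrite dvdn0.
have pp := primeP_nat p.
rewrite !pfactor_dvdn ?muln_gt0 ?a0 // lognM // -!ltnNge => lb la.
apply/negP; rewrite -ltnNge.
by apply: leq_trans (leq_add la lb); rewrite addSn addnS ltnS leqnSn.
Qed.

HB.instance Definition _ (p : prime_nat) :=
  GRing.ComUnitRing_isIntegral.Build (padic_int p) (@padic_integral p).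

Notation padic_num p := {fraction padic_int p}.

(* Homogeneous coordinates are indexed by 'I_4 and affine ones, as well as    *)
(* the divisors D_1, D_2, D_3, by j : 'I_3, standing for the index j + 1;     *)
(* thus x_0 is x ord0 and x_{j+1} is x (lift ord0 j).                         *)

Definition U_pt (m : int) (u : 'I_3 -> rat) : Prop :=
  \sum_(j < 3) u j ^+ 2 - \prod_(j < 3) u j = m%:~R.

(* Z_p being local, a point of P^3(Z_p) is given by coordinates, one of which *)
(* is a unit, up to multiplication by a unit.                                 *)
Definition calX_pt (p : prime_nat) (m : int) (x : 'I_4 -> padic_int p) : Prop :=
  (exists i, x i \is a GRing.unit) /\
  x ord0 * (\sum_(j < 3) x (lift ord0 j) ^+ 2) - \prod_(j < 3) x (lift ord0 j)
    = m%:~R * x ord0 ^+ 3.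

Definition same_pt (p : prime_nat) (u : 'I_3 -> rat)
    (x : 'I_4 -> padic_int p) : Prop :=
  x ord0 != 0 /\
  forall j : 'I_3, ratr (u j) =
    FracField.tofrac (x (lift ord0 j)) / FracField.tofrac (x ord0)
      :> padic_num p.

(* The homogeneous ideal of D_j = {x_0 = x_j = 0} over Q; it contains the     *)
(* equation of X_m.                                                           *)
Definition ideal_D (j : 'I_3) (f : {mpoly rat[4]}) : Prop :=
  exists a b : {mpoly rat[4]}, f = a * 'X_ord0 + b * 'X_(lift ord0 j).

(* The homogeneous ideal of the closure of D_j over Z.                        *)
Definition ideal_calD (j : 'I_3) (f : {mpoly int[4]}) : Prop :=
  ideal_D j (map_mpoly (intr : int -> rat) f).

(* The ideal I of Z_p such that Spec Z_p x_X D_j = Spec (Z_p / I), generated  *)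
(* by the values at x of the equations of the closure of D_j.                 *)
Definition pullback_calD (p : prime_nat) (j : 'I_3) (x : 'I_4 -> padic_int p)
    (a : padic_int p) : Prop :=
  exists (r : nat) (f : 'I_r -> {mpoly int[4]}) (c : 'I_r -> padic_int p),
    (forall i, ideal_calD j (f i)) /\
    a = \sum_(i < r) c i * mmap (intr : int -> padic_int p) x (f i).

(* In this file None : option nat stands for infinity.                        *)

(* contact_mult j x n says that n_p(D_j, x) = n.                              *)
Definition contact_mult (p : prime_nat) (j : 'I_3) (x : 'I_4 -> padic_int p)
    (n : option nat) : Prop :=
  match n with
  | None => forall a, pullback_calD j x a <-> a = 0
  | Some k => forall a,
      pullback_calD j x a <-> exists b : padic_int p, a = b * p%:R ^+ k
  end.

Definition campana_mult (w : nat) (n : option nat) : Prop :=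
  if n is Some k then (w <= k)%N \/ k = 0%N else True.

Definition darmon_mult (w : nat) (n : option nat) : Prop :=
  if n is Some k then (w %| k)%N else True.

(* A morphism Spec Z_p -> X_m avoids D_inf iff its pullback of each D_j with  *)
(* omega_j infinite is empty, i.e. is defined by the unit ideal.              *)
Definition avoids_Dinf (p : prime_nat) (omega : 'I_3 -> option nat)
    (x : 'I_4 -> padic_int p) : Prop :=
  forall j, omega j = None -> pullback_calD j x 1.

(* The lift x of u to Z_p is unique up to a unit, and the conditions on it do *)
(* not depend on that unit.                                                   *)
Definition strict_orbifold_pt (adm : nat -> option nat -> Prop) (m : int)
    (omega : 'I_3 -> option nat) (u : 'I_3 -> rat) : Prop :=
  U_pt m u /\
  forall p : prime_nat, exists x : 'I_4 -> padic_int p,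
    [/\ calX_pt m x, same_pt u x, avoids_Dinf omega x
      & forall j w, omega j = Some w ->
          exists2 n, contact_mult j x n & adm w n].

Definition strict_campana_pt := strict_orbifold_pt campana_mult.
Definition strict_darmon_pt := strict_orbifold_pt darmon_mult.

(* Main.v *)
Require Import Defs.
From mathcomp Require Import all_boot all_order all_algebra.
From mathcomp Require Import mpoly.
From mathcomp Require Import zify ring.

Set Implicit Arguments.
Unset Strict Implicit.
Unset Printing Implicit Defensive.

Import Order.TTheory GRing.Theory Num.Theory.
Local Open Scope ring_scope.

(**
Let D_i have finite weight w, and put u_i = 16. As 16^2 - 4 = 9 * 28 and
m - 16^2 = -3 q with q = 84 + l^2, the other two coordinates lie on the conic
(u - 8 v)^2 - 63 v^2 = -3 q. For u = (3 X + 8 Y) / 3^w and v = Y / 3^w this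
reads X^2 - 7 Y^2 = - 3^(2w-1) q. If 3 does not divide Y, the point so obtained
meets only D_i, only above the prime 3, and there with multiplicity w, so that
it is both a Campana and a Darmon point.

Since l^2 = -84 mod q and -3 is a square mod q, so is 7. Thue's lemma gives
x^2 - 7 y^2 = - k q with 0 <= k <= 6; residues mod 7 and 8 leave k = 3 and
k = 6, and the latter reduces to the former through an element of norm 2 of
Z[√7]. Multiplying by powers of (2 + √7)^2, of norm 9, gives X and Y.
*)

(** * Squares modulo 2, 8, 7 and 3 *)

(** Here and below, explicit quotients let [lia] reason with [x ^+ 2] as an atom. *)
Lemma sqrz_mod2 (x : int) : exists k : int, x ^+ 2 = x + 2 * k.
Proof.
have [c [->|->]] : exists c : int, x = 2 * c \/ x = 2 * c + 1.
- by exists (x %/ 2)%Z; lia.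
- by exists (2 * c ^+ 2 - c); ring.
- by exists (2 * c ^+ 2 + c); ring.
Qed.

Lemma sqrz_mod8 (x : int) :
  exists k : int, x ^+ 2 = 8 * k \/ x ^+ 2 = 8 * k + 1 \/ x ^+ 2 = 8 * k + 4.
Proof.
have [c [r [-> rP]]] : exists c r : int, x = 4 * c + r /\ 0 <= r < 4.
  by exists (x %/ 4)%Z, (x %% 4)%Z; split; lia.
have : r = 0 \/ r = 1 \/ r = 2 \/ r = 3 by lia.
case=> [->|[->|[->|->]]].
- by exists (2 * c ^+ 2); lia.
- by exists (2 * c ^+ 2 + c); lia.
- by exists (2 * c ^+ 2 + 2 * c); lia.
- by exists (2 * c ^+ 2 + 3 * c + 1); lia.
Qed.

Lemma sqrz_mod7 (x : int) :
  exists k : int, ((7 %| x)%Z /\ x ^+ 2 = 7 * k) \/ x ^+ 2 = 7 * k + 1 \/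
                     x ^+ 2 = 7 * k + 2 \/ x ^+ 2 = 7 * k + 4.
Proof.
have [c [r [-> rP]]] : exists c r : int, x = 7 * c + r /\ 0 <= r < 7.
  by exists (x %/ 7)%Z, (x %% 7)%Z; split; lia.
have : [|| r == 0, r == 1, r == 2, r == 3, r == 4, r == 5 | r == 6] by lia.
case/or4P=> [/eqP->|/eqP->|/eqP->|/or4P[] /eqP->].
- by exists (7 * c ^+ 2); lia.
- by exists (7 * c ^+ 2 + 2 * c); lia.
- by exists (7 * c ^+ 2 + 4 * c); lia.
- by exists (7 * c ^+ 2 + 6 * c + 1); lia.
- by exists (7 * c ^+ 2 + 8 * c + 2); lia.
- by exists (7 * c ^+ 2 + 10 * c + 3); lia.
- by exists (7 * c ^+ 2 + 12 * c + 5); lia.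
Qed.

Lemma sqrz_mod3 (x : int) :
  exists k : int, ((3 %| x)%Z /\ x ^+ 2 = 9 * k) \/
                  (~~ (3 %| x)%Z /\ x ^+ 2 = 3 * k + 1).
Proof.
have [c [r [-> rP]]] : exists c r : int, x = 3 * c + r /\ 0 <= r < 3.
  by exists (x %/ 3)%Z, (x %% 3)%Z; split; lia.
have : r = 0 \/ r = 1 \/ r = 2 by lia.
case=> [->|[->|->]].
- by exists (c ^+ 2); left; split; [lia | ring].
- by exists (3 * c ^+ 2 + 2 * c); right; split; [lia | ring].
- by exists (3 * c ^+ 2 + 4 * c + 1); right; split; [lia | ring].
Qed.

(** * Thue's lemma *)

Lemma thue_lemma (q : nat) (a b : int) : (0 < q)%N ->
  exists x y : int, [/\ (x != 0) || (y != 0), (q%:Z %| a * x + b * y)%Z,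
    x ^+ 2 <= q%:Z & y ^+ 2 <= q%:Z].
Proof.
move=> q_gt0.
have [s [sP1 sP2]] : exists s : nat, (s ^ 2 <= q)%N /\ (q < s.+1 ^ 2)%N.
  have ex0 : exists s, (s ^ 2 <= q)%N by exists 0%N.
  have bnd s : (s ^ 2 <= q)%N -> (s <= q)%N by nia.
  have [s sP smax] := ex_maxnP ex0 bnd.
  exists s; split=> //; rewrite ltnNge; apply/negP => /smax; lia.
(* Pigeonhole: (s + 1)^2 > q pairs share q residues, and coordinates of two pairs differ by at most
   [s]. The successor form [q.-1.+1] serves [inord]. *)
pose f (t : 'I_s.+1 * 'I_s.+1) : 'I_q.-1.+1 :=
  inord `|((a * (t.1 : nat)%:Z + b * (t.2 : nat)%:Z) %% q%:Z)%Z|%N.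
have /injectivePn [t [t' tt' ft]] : ~~ injectiveb f.
  apply/negP => /injectiveP /leq_card; rewrite card_prod !card_ord; nia.
have modP (z : int) : (`|(z %% q%:Z)%Z|%N < q.-1.+1)%N by lia.
have := congr1 (@nat_of_ord _) ft; rewrite !inordK ?modP // => e.
exists ((t.1 : nat)%:Z - (t'.1 : nat)%:Z), ((t.2 : nat)%:Z - (t'.2 : nat)%:Z).
have [h1 h2 h3 h4] :
  [/\ (t.1 < s.+1)%N, (t.2 < s.+1)%N, (t'.1 < s.+1)%N & (t'.2 < s.+1)%N].
  by rewrite !ltn_ord.
split; [| |nia|nia].
- apply: contraNT tt'; rewrite negb_or !negbK !subr_eq0 => /andP[/eqP e1 /eqP e2].
  by apply/eqP; case: t t' e1 e2 {ft e h1 h2 h3 h4} => [? ?] [? ?] /= [e1] [e2];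
     congr pair; apply/val_inj.
- have {e} : ((a * (t.1 : nat)%:Z + b * (t.2 : nat)%:Z) =
     (a * (t'.1 : nat)%:Z + b * (t'.2 : nat)%:Z) %[mod q%:Z])%Z by lia.
  move/eqP; rewrite eqz_mod_dvd; congr (_ %| _)%Z; ring.
Qed.

(** * Values of the norm form x^2 - 7 y^2 *)

(** For nonzero [y] the exponent of 7 would be even on the left and odd on the right. *)
Lemma sqr_neq_7sqr (x y : int) : x ^+ 2 = 7 * y ^+ 2 -> x = 0 /\ y = 0.
Proof.
move=> e; have [y0|y0] := eqVneq y 0.
  by split=> //; apply/eqP; rewrite -sqrf_eq0 e y0.
have x0 : x != 0 by apply: contra_neq y0 => x0; move: e; rewrite x0; nia.
have /(congr1 (logn 7)) : (`|x| ^ 2 = 7 * `|y| ^ 2)%N.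
  by move/(congr1 absz): e; rewrite abszM !abszX.
rewrite lognM ?expn_gt0 ?absz_gt0 ?y0 // !lognX (_ : logn 7 7 = 1%N) //; lia.
Qed.

Lemma norm_m3_of_dvd_norm (q : nat) (x y : int) :
    (exists k : int, q%:Z = 8 * k + 5) ->
    (exists k : int, q%:Z = 7 * k + 1 \/ q%:Z = 7 * k + 2 \/ q%:Z = 7 * k + 4) ->
    (x != 0) || (y != 0) -> (q%:Z %| x ^+ 2 - 7 * y ^+ 2)%Z ->
    x ^+ 2 <= q%:Z -> y ^+ 2 <= q%:Z ->
  exists x' y' : int, x' ^+ 2 - 7 * y' ^+ 2 = - (3 * q%:Z).
Proof.
move=> [k8 q8] [k7 q7] xy0 /dvdzP[k ek] xq yq.
have [a8 xa8] := sqrz_mod8 x; have [b8 yb8] := sqrz_mod8 y.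
have [a7 xa7] := sqrz_mod7 x.
(* Being 5 modulo 8, [q] is not a square. *)
have x_lt : x ^+ 2 < q%:Z by lia.
have y_lt : y ^+ 2 < q%:Z by lia.
have q_gt0 : 0 < q%:Z by lia.
have k_gt : -7 < k.
  by rewrite -(ltr_pM2r q_gt0) -ek; move: (sqr_ge0 x); clear -y_lt; lia.
have k_lt : k < 1.
  by rewrite -(ltr_pM2r q_gt0) -ek; move: (sqr_ge0 y); clear -x_lt; lia.
have : [|| k == 0, k == -1, k == -2, k == -3, k == -4, k == -5 | k == -6].
  by clear -k_gt k_lt; lia.
(* For [k] = -1, -2, -4, the product k q is a non-residue modulo 7; for [k] = -5, x^2 + y^2 would be
   7 modulo 8. *)
case/or4P=> [/eqP k0|/eqP k1|/eqP k2|/or4P[] /eqP k3]; subst k.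
- have [x0 y0] : x = 0 /\ y = 0 by apply: sqr_neq_7sqr; lia.
  by move: xy0; rewrite x0 y0.
- by exfalso; lia.
- by exfalso; lia.
- by exists x, y; lia.
- by exfalso; lia.
- by exfalso; lia.
- (* (x + y √7)(3 - √7)/2, the factor (3 - √7)/2 having norm 1/2 *)
  have [c xc] : exists c, 3 * x - 7 * y = 2 * c.
    have [a xa] := sqrz_mod2 x; have [b yb] := sqrz_mod2 y.
    exists ((3 * x - 7 * y) %/ 2)%Z; clear -ek xa yb; lia.
  have [d yd] : exists d, 3 * y - x = 2 * d by exists (x - 2 * y - c); lia.
  exists c, d; apply: (@mulfI _ 4) => //.
  transitivity ((2 * c) ^+ 2 - 7 * (2 * d) ^+ 2); first by ring.
  rewrite -xc -yd; transitivity (2 * (x ^+ 2 - 7 * y ^+ 2)); first by ring.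
  by rewrite ek; ring.
Qed.

(* The norm form is multiplied by that of (2 + √7)^2 = 11 + 4 √7, which is 9; *)
(* the residue of x - y mod 3 is the image of x + y √7 under √7 |-> -1, which *)
(* maps 2 + √7 to 1.                                                          *)
Lemma norm_m3_pow9 (q x y : int) (n : nat) :
    x ^+ 2 - 7 * y ^+ 2 = - (3 * q) -> ~~ (3 %| q)%Z ->
  exists x' y' : int, x' ^+ 2 - 7 * y' ^+ 2 = - (3 * 9 ^+ n * q)
                      /\ ~~ (3 %| y')%Z.
Proof.
move=> e q3.
(* If 3 divides [y'], the equation makes it divide [x'], hence [x' - y']. *)
suff [x' [y' [e' /negP xy3]]] : exists x' y' : int,
    x' ^+ 2 - 7 * y' ^+ 2 = - (3 * 9 ^+ n * q) /\ ~~ (3 %| x' - y')%Z.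
  exists x', y'; split=> //; apply/negP => y3; apply: xy3.
  have [a [[x3 _]|[x3 xa]]] := sqrz_mod3 x'; first exact: rpredB.
  have [b [[_ yb]|[y3' yb]]] := sqrz_mod3 y'; last by rewrite y3 in y3'.
  by move: e'; rewrite -mulrA; set c := _ * q; lia.
elim: n => [|n [x' [y' [e' xy3]]]].
  have [a xa] := sqrz_mod3 x; have [b yb] := sqrz_mod3 y.
  (* If 3 divided both x - y and x + y, it would divide [x] and [y], so 9 would divide 3 q. *)
  have [xy3|xy3] := boolP (3 %| x - y)%Z.
    by exists x, (- y); rewrite sqrrN expr0 mulr1; split=> //; lia.
  by exists x, y; rewrite expr0 mulr1.
exists (11 * x' + 28 * y'), (4 * x' + 11 * y'); split; last by lia.
transitivity (9 * (x' ^+ 2 - 7 * y' ^+ 2)); first by ring.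
by rewrite e' exprS; ring.
Qed.

Lemma norm_m3_84l2 (l : nat) (s : int) : prime l -> (17 <= l)%N ->
    (s ^+ 2 = - 3%:Z %[mod 84%:Z + l%:Z ^+ 2])%Z ->
  exists x y : int, x ^+ 2 - 7 * y ^+ 2 = - (3 * (84 + l%:Z ^+ 2)).
Proof.
move=> l_prime l_ge17 sq.
pose q := (84 + l ^ 2)%N.
have qE : q%:Z = 84%:Z + l%:Z ^+ 2 by rewrite /q; lia.
rewrite -qE in sq *.
have l_ndvd p : prime p -> (p < 17)%N -> ~~ (p %| l)%N.
  move=> p_prime p_lt; rewrite dvdn_prime2 //; apply/negP => /eqP; lia.
have l2 := l_ndvd 2 isT isT; have l3 := l_ndvd 3 isT isT.
have l7 := l_ndvd 7 isT isT.
have ql : coprimez q%:Z (l%:Z ^+ 2).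
  rewrite coprimezXr // coprimezE /= coprime_sym prime_coprime //.
  rewrite dvdn_addl ?dvdn_mulr //; apply/negP.
  rewrite (_ : 84%N = (2 * 2 * 3 * 7)%N) // !Euclid_dvdM // !dvdn_prime2 //; lia.
(* Modulo [q], (14 s)^2 = -7 * 84 = 7 l^2, so (l x + 14 s y)(l x - 14 s y) = l^2 (x^2 - 7 y^2),
   where [l] is invertible. *)
have [x [y [xy0 qxy xq yq]]] := @thue_lemma q l%:Z (14 * s) isT.
apply: (@norm_m3_of_dvd_norm q x y) => //.
- have [k lk] := sqrz_mod8 l%:Z; have [c lc] := sqrz_mod2 l%:Z.
  by exists (k + 10); clear -lk lc l2 qE; lia.
- have [k lk] := sqrz_mod7 l%:Z; exists (k + 12); clear -lk l7 qE; lia.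
- rewrite -(@Gauss_dvdzr _ (l%:Z ^+ 2)) //.
  move/eqP: sq; rewrite eqz_mod_dvd => sq.
  rewrite (_ : _ * _ = (l%:Z * x + 14 * s * y) * (l%:Z * x - 14 * s * y)
    + (s ^+ 2 - - 3%:Z) * (196 * y ^+ 2) - q%:Z * (7 * y ^+ 2)); last first.
    by rewrite qE; ring.
  by rewrite rpredB ?rpredD ?dvdz_mulr.
Qed.

(** * Integers in Z_p *)

Lemma padic_cstE (p : prime_nat) (z : int) : padic_cst p z = z%:~R.
Proof.
have cstN y : padic_cst p (- y) = - padic_cst p y.
  by apply: padic_ext => n /=; rewrite modzNm.
have cst_nat k : padic_cst p k%:Z = k%:R.
  elim: k => // k IHk; rewrite -natr1 -IHk; apply: padic_ext => n /=.
  by rewrite modzDm addrC -intS.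
case: z => k; first exact: cst_nat.
by rewrite NegzE cstN cst_nat mulrNz.
Qed.

Lemma padic_intr_eq0 (p : prime_nat) (z : int) :
  ((z%:~R : padic_int p) == 0) = (z == 0).
Proof.
apply/eqP/eqP => [|-> //].
(* The component of index |z| suffices, since p^|z| > |z|. *)
rewrite -padic_cstE => /(congr1 (fun a : padic_int p => a `|z|%N)) /=.
rewrite mod0z => /dvdz_mod0P; rewrite dvdzE abszX /= => dvd_z.
apply/eqP; rewrite -absz_eq0 -leqn0 leqNgt; apply/negP => /dvdn_leq /(_ dvd_z).
by rewrite leqNgt ltn_expl // prime_gt1 // primeP_nat.
Qed.

(** Bezout inverts [z] modulo each p^n; uniqueness of these inverses makes them coherent. *)
Lemma padic_intr_unit (p : prime_nat) (z : int) :
  ~~ (p%:Z %| z)%Z -> (z%:~R : padic_int p) \is a GRing.unit.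
Proof.
move=> pz; have cop n : coprimez z (p%:Z ^+ n).
  rewrite coprimezE abszX /= coprimeXr // coprime_sym prime_coprime ?primeP_nat //.
have inv n : exists c : int, (c * z == 1 %[mod p%:Z ^+ n])%Z.
  have /coprimezP[[c d] /= cd] := cop n; exists c.
  by rewrite eqz_mod_dvd -cd opprD addNKr rpredN dvdz_mull.
pose f n := xchoose (inv n).
have fP n : (p%:Z ^+ n %| f n * z - 1)%Z.
  by rewrite -eqz_mod_dvd; exact: (xchooseP (inv n)).
have f_coh : coherent p f.
  move=> n; apply/eqP; rewrite eqz_mod_dvd.
  rewrite -(@Gauss_dvdzl _ _ z); last by rewrite coprimez_sym.
  rewrite (_ : _ * z = (f n.+1 * z - 1) - (f n * z - 1)); last by ring.
  by rewrite rpredB //; apply: dvdz_trans (fP n.+1); rewrite exprS dvdz_mull.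
apply/unitrPr; exists (padic_of f_coh); rewrite -padic_cstE.
apply: padic_ext => n /=; rewrite modzMm mulrC.
by apply/eqP; rewrite eqz_mod_dvd.
Qed.

Lemma ratr_div_int (F : fieldType) (a b : int) :
    (forall z : int, (z%:~R == 0 :> F) = (z == 0)) -> b != 0 ->
  ratr (a%:~R / b%:~R) = a%:~R / b%:~R :> F.
Proof.
move=> char0 b0; rewrite /ratr; set r := _ / _.
apply/eqP; rewrite eqr_div ?char0 ?denq_neq0 // -!intrM.
rewrite -subr_eq0 -intrB char0 subr_eq0 -(@eqr_int rat) !intrM.
by rewrite -eqr_div ?intr_eq0 ?denq_neq0 // divq_num_den.
Qed.

(** * The ideal cut out on Spec Z_p by the closure of D_j *)

Lemma mcoeffMX_eq0 (R : nzRingType) (n : nat) (f : {mpoly R[n]})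
    (i : 'I_n) (m : 'X_{1..n}) :
  m i = 0%N -> (f * 'X_i)@_m = 0.
Proof.
move=> mi; apply: memN_msupp_eq0; rewrite (perm_mem (msuppMX _ _)).
by apply/mapP => -[m' _ mE]; move: mi; rewrite mE mnmDE mnm1E eqxx.
Qed.

(** As the ideal of D_j is monomial, every monomial of an integral polynomial in it is divisible by
    x_0 or x_j. So x_0 and x_j generate the ideal of the closure over Z too. *)
Lemma pullback_calDP (p : prime_nat) (j : 'I_3) (x : 'I_4 -> padic_int p) a :
  pullback_calD j x a <->
  exists b c, a = b * x ord0 + c * x (lift ord0 j).
Proof.
pose J a := exists b c, a = b * x ord0 + c * x (lift ord0 j).
have J0 : J 0 by exists 0, 0; rewrite !mul0r addr0.
have JD u v : J u -> J v -> J (u + v).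
  by move=> [b [c ->]] [b' [c' ->]]; exists (b + b'), (c + c'); ring.
have JM u v : J v -> J (u * v).
  by move=> [b [c ->]]; exists (u * b), (u * c); ring.
split=> [[r [f [c [fD ->]]]]|[b [c ->]]].
  apply: (big_ind J) => // i _; apply/JM; have [g [h fE]] := fD i.
  rewrite /mmap big_seq; apply: (big_ind J) => // m; rewrite mcoeff_msupp => fm.
  apply/JM; suff [k [km kD]] : exists k, m k != 0%N /\ J (x k).
    rewrite /mmap1 (bigD1 k) //= mulrC; apply/JM.
    by move: km; case: (m k) => // n _; rewrite exprS mulrC; apply/JM.
  have [m0|m0] := eqVneq (m ord0) 0%N; last first.
    by exists ord0; split=> //; exists 1, 0; ring.
  exists (lift ord0 j); split; last by exists 0, 1; ring.
  apply: contraNneq fm => mj.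
  rewrite -(@intr_eq0 rat) -mcoeff_map_mpoly fE mcoeffD.
  by rewrite !mcoeffMX_eq0 // addr0.
exists 2, (fun i => if i == ord0 then 'X_ord0 else 'X_(lift ord0 j)).
exists (fun i => if i == ord0 then b else c); split=> [i|].
  case: eqP => _; rewrite /ideal_calD map_mpolyX /ideal_D.
    by exists 1, 0; rewrite mul1r mul0r addr0.
  by exists 0, 1; rewrite mul1r mul0r add0r.
by rewrite !big_ord_recl big_ord0 /= addr0 !mmapX !mmap1U.
Qed.

Lemma contact_mult0 (p : prime_nat) (j : 'I_3) (x : 'I_4 -> padic_int p) :
  pullback_calD j x 1 -> contact_mult j x (Some 0%N).
Proof.
move=> /pullback_calDP [b [c e1]] a; rewrite expr0.
split=> [_|[u ->]]; first by exists a; rewrite mulr1.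
by apply/pullback_calDP; exists (u * b), (u * c); rewrite e1; ring.
Qed.

Lemma pullback_calD_unit (p : prime_nat) (j : 'I_3) (x : 'I_4 -> padic_int p) :
  (x ord0 \is a GRing.unit) || (x (lift ord0 j) \is a GRing.unit) ->
  pullback_calD j x 1.
Proof.
case/orP=> xu; apply/pullback_calDP.
- by exists (x ord0)^-1, 0; rewrite mulVr // mul0r addr0.
- by exists 0, (x (lift ord0 j))^-1; rewrite mulVr // mul0r add0r.
Qed.

(** * Orbifold points from integral coordinates *)

Lemma same_pt_int (p : prime_nat) (d : int) (v : 'I_3 -> int)
    (x : 'I_4 -> padic_int p) : d != 0 ->
    x ord0 = d%:~R -> (forall j, x (lift ord0 j) = (v j)%:~R) ->
  same_pt (fun j => (v j)%:~R / d%:~R) x.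
Proof.
move=> d0 x0 xj; split; first by rewrite x0 padic_intr_eq0.
move=> j; rewrite x0 xj !rmorph_int ratr_div_int // => z.
by rewrite -(rmorph_int (@FracField.tofrac _)) tofrac_eq0 padic_intr_eq0.
Qed.

(** Away from [r], x_0 = [d] is a unit; above [r], so is every [v j] with [j != j0]. Hence only the
    divisor of index [j0] is met, along the ideal (d, v j0) = (r^w). *)
Lemma strict_orbifold_pt_int (adm : nat -> option nat -> Prop) (m : int)
    (omega : 'I_3 -> option nat) (j0 : 'I_3) (w r d : nat) (v : 'I_3 -> int) :
    (forall k, adm k (Some 0%N)) -> adm w (Some w) ->
    omega j0 = Some w -> prime r -> d = (r ^ w)%N ->
    (d%:Z %| v j0)%Z -> (forall j, j != j0 -> ~~ (r%:Z %| v j)%Z) ->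
    d%:Z * (\sum_(j < 3) v j ^+ 2) - \prod_(j < 3) v j = m * d%:Z ^+ 3 ->
  strict_orbifold_pt adm m omega (fun j => (v j)%:~R / d%:~R).
Proof.
move=> adm0 admw omj0 r_prime dE v_j0 v_j eqX.
have d0 : d%:Z != 0 by rewrite dE -lt0n expn_gt0 prime_gt0.
split.
  have d0' : (d%:~R : rat) != 0 by rewrite intr_eq0.
  apply: (mulfI (expf_neq0 3 d0')).
  rewrite [in RHS]mulrC -[in RHS]rmorphXn -[in RHS]intrM -eqX.
  rewrite !big_ord_recl !big_ord0 /= !(rmorphB, rmorphD, rmorphM, rmorphXn) /=.
  by field.
move=> p.
pose x (i : 'I_4) : padic_int p :=
  if unlift ord0 i is Some j then (v j)%:~R else d%:~R.
have x0 : x ord0 = d%:~R by rewrite /x unlift_none.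
have xj j : x (lift ord0 j) = (v j)%:~R by rewrite /x liftK.
have x0_unit : (p : nat) != r -> x ord0 \is a GRing.unit.
  move=> pr; rewrite x0 padic_intr_unit // dvdzE /= dE.
  by rewrite Euclid_dvdX ?dvdn_prime2 ?primeP_nat // (negPf pr).
have pull1 j : ((p : nat) != r) || (j != j0) -> pullback_calD j x 1.
  move=> prj; apply: pullback_calD_unit.
  have [pr|/x0_unit->//] := eqVneq (p : nat) r.
  by move: prj; rewrite pr eqxx /= xj orbC => /v_j h; rewrite padic_intr_unit ?pr.
exists x; split.
- split.
    have [pr|/x0_unit] := eqVneq (p : nat) r; last by exists ord0.
    (* Above [r], a coordinate of index other than [j0] is the required unit. *)
    have [j jj0] : exists j : 'I_3, j != j0.
      by exists (if j0 == 0 then 1 else 0); case: ifP => [/eqP->|/negbT] //;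
        rewrite eq_sym.
    by exists (lift ord0 j); rewrite xj padic_intr_unit // pr v_j.
  rewrite x0; under eq_bigr do rewrite xj -rmorphXn.
  under [X in _ - X]eq_bigr do rewrite xj.
  by rewrite -rmorph_sum -rmorph_prod -rmorphXn -!rmorphM -rmorphB /= eqX.
- exact: same_pt_int.
- move=> j oj; apply/pull1/orP; right.
  by apply: contra_eq_neq oj => ->; rewrite omj0.
- move=> j w' oj; have [jj0|jj0] := eqVneq j j0; last first.
    by exists (Some 0%N) => //; apply/contact_mult0/pull1; rewrite jj0 orbT.
  have [pr|pr] := eqVneq (p : nat) r; last first.
    by exists (Some 0%N) => //; apply/contact_mult0/pull1; rewrite pr.
  subst j; move: oj; rewrite omj0 => -[<-]; exists (Some w) => // a.
  have dX : d%:~R = p%:R ^+ w :> padic_int p by rewrite pr -natrX dE.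
  have /dvdzP[c vE] := v_j0.
  split=> [/pullback_calDP[b [b' ->]]|[b ->]].
    by exists (b + b' * c%:~R); rewrite x0 xj vE intrM dX; ring.
  by apply/pullback_calDP; exists b, 0; rewrite x0 dX mul0r addr0.
Qed.

(** * The point on the conic *)

(** An abstract [adm] accepting the multiplicities 0 and [w] covers Campana and Darmon points at
    once. *)
Lemma strict_orbifold_pt_ex (adm : nat -> option nat -> Prop) (l : nat)
    (omega : 'I_3 -> option nat) (j0 : 'I_3) (w : nat) (s : int) :
    prime l -> (17 <= l)%N ->
    (s ^+ 2 = - 3%:Z %[mod 84%:Z + l%:Z ^+ 2])%Z ->
    (forall k, adm k (Some 0%N)) -> (0 < w)%N -> adm w (Some w) ->
    omega j0 = Some w ->
  exists u, strict_orbifold_pt adm (4%:Z - 3%:Z * l%:Z ^+ 2) omega u.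
Proof.
move=> l_prime l_ge17 sq adm0 w_gt0 admw omj0.
have [x [y xy]] := norm_m3_84l2 l_prime l_ge17 sq.
have q3 : ~~ (3 %| 84 + l%:Z ^+ 2)%Z.
  have l3 : ~~ (3 %| l)%N by rewrite dvdn_prime2 //; lia.
  have [k lk] := sqrz_mod3 l%:Z; clear -l3 lk; lia.
(* The exponent [w.-1] gives 3 * 9^(w-1) = 3^(2w-1). *)
have [X [Y [XY Y3]]] := norm_m3_pow9 w.-1 xy q3.
pose d := (3 ^ w)%N.
pose v j : int := if j == j0 then 16 * d%:Z
  else if j == ordS j0 then 3 * X + 8 * Y else Y.
exists (fun j => (v j)%:~R / d%:~R).
apply: (@strict_orbifold_pt_int _ _ _ j0 w 3 d v) => //.
- by rewrite /v eqxx dvdz_mull.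
(* Modulo 3, 3 X + 8 Y is 2 Y. *)
- by move=> j /negPf jj0; rewrite /v jj0; case: ifP; clear -Y3; lia.
have dXY : 9 * (X ^+ 2 - 7 * Y ^+ 2) = - (3 * (84 + l%:Z ^+ 2) * d%:Z ^+ 2).
  have -> : d%:Z ^+ 2 = 9 * 9 ^+ w.-1.
    by rewrite -exprS prednK // /d -natz natrX -exprM mulnC exprM.
  by rewrite XY; ring.
have -> : \sum_(j < 3) v j ^+ 2
    = (16 * d%:Z) ^+ 2 + (3 * X + 8 * Y) ^+ 2 + Y ^+ 2.
  by rewrite !big_ord_recl big_ord0 /v; case: j0 {omj0 v} => [[|[|[|//]]] ?] /=; ring.
have -> : \prod_(j < 3) v j = 16 * d%:Z * (3 * X + 8 * Y) * Y.
  by rewrite !big_ord_recl big_ord0 /v; case: j0 {omj0 v} => [[|[|[|//]]] ?] /=; ring.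
(* The cross terms 48 X Y cancel, and 64 + 1 - 128 = -63 = -9 * 7. *)
transitivity (256 * d%:Z ^+ 3 + d%:Z * (9 * (X ^+ 2 - 7 * Y ^+ 2))).
  by ring.
by rewrite dXY; ring.
Qed.

Theorem theorem4p5 (l : nat) (omega : 'I_3 -> option nat)
    (l_prime : prime l) (l_ge17 : (17 <= l)%N)
    (omega_ge2 : forall j w, omega j = Some w -> (2 <= w)%N)
    (omega_fin : exists j w, omega j = Some w)
    (sqr_m3 : exists x : int, (x ^+ 2 = - 3%:Z %[mod 84%:Z + l%:Z ^+ 2])%Z) :
  (exists u : 'I_3 -> rat, strict_campana_pt (4%:Z - 3%:Z * l%:Z ^+ 2) omega u) /\
  (exists u : 'I_3 -> rat, strict_darmon_pt (4%:Z - 3%:Z * l%:Z ^+ 2) omega u).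
Proof.
have [j0 [w omj0]] := omega_fin; have [s sq] := sqr_m3.
have w_gt0 : (0 < w)%N := ltnW (omega_ge2 _ _ omj0).
split; apply: (strict_orbifold_pt_ex l_prime l_ge17 sq _ w_gt0 _ omj0) => [k|] /=.
- by right.
- by left.
- exact: dvdn0.
- exact: dvdnn.
Qed.
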